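(* Let $C_\phi$ be a composition operator on a directed graph with one circuit (as defined in the context) and suppose that $C_\phi\in\boldsymbol B(L^2(\mu))$ is a $2$-isometry. Then $C_\phi$ does not satisfy the kernel condition.
   Context: Setting. $\mathbb N=\{1,2,\ldots\}$. Let $\kappa\in\mathbb N$, $\eta\in\mathbb N\cup\{\infty\}$, $J_{[1,\eta]}=\{i\in\mathbb N: i\le\eta\}$ (so $J_{[1,\infty]}=\mathbb N$), and let $X=\{x_1,\ldots,x_\kappa\}\cup\{x_{i,j}: i\in J_{[1,\eta]},\, j\in\mathbb N\}$, all the listed points being distinct. Let $\mathscr A$ be the $\sigma$-algebra of all subsets of $X$ and $\mu$ a positive measure on $\mathscr A$ with $\mu(x):=\mu(\{x\})\in(0,\infty)$ for all $x\in X$. Define $\phi\colon X\to X$ by $\phi(x_{i,j})=x_{i,j-1}$ for $j\ge2$, $\phi(x_{i,1})=x_\kappa$, $\phi(x_1)=x_\kappa$, and $\phi(x_i)=x_{i-1}$ for $2\le i\le\kappa$. The operator $C_\phi f=f\circ\phi$ in the complex space $L^2(\mu)=L^2(X,\mathscr A,\mu)$ is called a composition operator on a directed graph with one circuit. $C_\phi\in\boldsymbol B(L^2(\mu))$ means that $C_\phi$ is everywhere defined and bounded on $L^2(\mu)$. A bounded operator $T$ on a Hilbert space is a $2$-isometry if $I-2T^*T+T^{*2}T^2=0$. $T$ satisfies the kernel condition if $T^*T\,\mathcal N(T^* )\subseteq\mathcal N(T^* )$, where $\mathcal N(\cdot)$ denotes the kernel. *)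

(* Defs.v *)
From HB Require Import structures.
From mathcomp Require Import all_boot all_order all_algebra.
From mathcomp Require Import all_classical all_reals all_analysis.
From mathcomp Require Import complex.

Set Implicit Arguments.
Unset Strict Implicit.
Unset Printing Implicit Defensive.

Import Order.TTheory GRing.Theory Num.Theory.
Import ComplexField.Normc.
Local Open Scope classical_set_scope.
Local Open Scope ring_scope.

(* J_[1, eta], with eta = None encoding infinity; the elements i of J_[1, eta]
   are represented by i.-1. *)
Definition branch_index (eta : option nat) : Type :=
  {i : nat | if eta is Some n then (i < n)%N else true}.

(* The circuit has kappa = k.+1 >= 1 points. Indices are shifted by one:
   Circuit i is x_{i+1}, and Branch i j is x_{i+1,j+1}. *)
Inductive vertex (k : nat) (eta : option nat) : Type :=
  | Circuit of 'I_k.+1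
  | Branch of branch_index eta & nat.
Arguments Circuit {k eta}.
Arguments Branch {k eta}.

HB.instance Definition _ k eta := gen_eqMixin (vertex k eta).
HB.instance Definition _ k eta := gen_choiceMixin (vertex k eta).
HB.instance Definition _ k eta :=
  isPointed.Build (vertex k eta) (Circuit ord_max).
HB.instance Definition _ k eta :=
  @isMeasurable.Build default_measure_display (vertex k eta)
    discrete_measurable discrete_measurable0
    discrete_measurableC discrete_measurableU.

(* ord_pred is the cyclic predecessor, so that x_1 is sent to x_kappa. *)
Definition phi (k : nat) (eta : option nat) (x : vertex k eta) : vertex k eta :=
  match x with
  | Circuit i => Circuit (ord_pred i)
  | Branch i j.+1 => Branch i j
  | Branch _ 0 => Circuit ord_max
  end.

Section L2.
Context {R : realType} {k : nat} {eta : option nat}.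
Variable mu : {measure set (vertex k eta) -> \bar R}.

Definition L2norm (f : vertex k eta -> R[i]) : \bar R :=
  'N[mu]_2%:E[EFin \o (@normc R \o f)]%E.

(* All functions are measurable for the discrete sigma-algebra. No quotient by
   almost everywhere equality is taken: it is trivial when every point has
   positive mass. *)
Definition L2fun : {pred vertex k eta -> R[i]} :=
  mem [set f | (L2norm f < +oo)%E].

Lemma le_L2norm (f g : vertex k eta -> R) :
  (forall x, 0 <= f x <= g x) ->
  ('N[mu]_2%:E[EFin \o f] <= 'N[mu]_2%:E[EFin \o g])%E.
Proof.
move=> fg; rewrite unlock /Lnorm.
apply: gt0_ler_poweR; rewrite ?invr_ge0 ?in_itv/= ?leey ?andbT//.
- by apply: integral_ge0 => x _; rewrite /= lee_fin powR_ge0.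
- by apply: integral_ge0 => x _; rewrite /= lee_fin powR_ge0.
apply: ge0_le_integral => //.
move=> x _; have /andP[f0 fgx] := fg x.
rewrite lee_fin ge0_ler_powR ?nnegrE ?normr_ge0//.
by rewrite !ger0_norm// (le_trans f0).
Qed.

Lemma L2fun_submod_closed : submod_closed L2fun.
Proof.
split=> [|a f g]; rewrite !inE/=.
  rewrite /L2norm (_ : EFin \o _ = cst 0%E) ?Lnorm0 ?ltry//.
  by apply/funext => x /=; rewrite expr0n/= addr0 sqrtr0.
move=> f2 g2; pose F := @normc R \o f; pose G := @normc R \o g.
have n0 (z : R[i]) : 0 <= normc z by case: z => u v; exact: sqrtr_ge0.
have LF (h : vertex k eta -> R) :
    ('N[mu]_2%:E[EFin \o h] < +oo)%E -> h \in Lfun mu 2%:E.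
  by move=> ?; apply/andP; rewrite !inE/=; split.
have p1 : (1 <= (2 : R)%:E)%E by rewrite lee_fin ler1n.
rewrite ?inE/= in f2 g2 *.
have le1 : (L2norm (a *: f + g)%R <=
    'N[mu]_2%:E[EFin \o ((normc a \*: F) \+ G)%R])%E.
  rewrite /L2norm; apply: le_L2norm => x.
  rewrite n0/= (le_trans (le_normcD _ _))//.
  by rewrite normcM.
apply: (le_lt_trans le1).
have [_ /(_ (normc a) F G (LF _ f2) (LF _ g2))] := Lfun_submod_closed mu p1.
by move=> /andP[_]; rewrite inE.
Qed.

HB.instance Definition _ := GRing.isSubmodClosed.Build _ _ L2fun
  L2fun_submod_closed.

Record L2 : Type := MkL2 { L2val :> vertex k eta -> R[i]; _ : L2val \in L2fun }.

HB.instance Definition _ := [isSub for L2val].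
HB.instance Definition _ := [Choice of L2 by <:].
HB.instance Definition _ := [SubChoice_isSubLmodule of L2 by <:].

Definition inner (f g : L2) : R[i] :=
  Complex (\int[mu]_x complex.Re (f x * (g x)^*%C))
          (\int[mu]_x complex.Im (f x * (g x)^*%C)).

Definition bounded_operator (T : L2 -> L2) : Prop :=
  linear T /\ exists M : R, forall f, (L2norm (T f) <= M%:E * L2norm f)%E.

(* The Hilbert space adjoint: for T bounded and linear and mu positive on
   points, adjoint T g is the unique h such that <T f, g> = <f, h> for all f. *)
Definition adjoint (T : L2 -> L2) (g : L2) : L2 :=
  xget 0 [set h | forall f, inner (T f) g = inner f h].

Definition kernel (T : L2 -> L2) : set L2 := [set f | T f = 0].

Definition two_isometry (T : L2 -> L2) : Prop :=
  forall f, f - 2%:R *: adjoint T (T f) + adjoint T (adjoint T (T (T f))) = 0.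

Definition kernel_condition (T : L2 -> L2) : Prop :=
  (adjoint T \o T) @` kernel (adjoint T) `<=` kernel (adjoint T).

(* T = C_phi, and C_phi is everywhere defined on L^2(mu). *)
Definition is_composition_operator (T : L2 -> L2) : Prop :=
  forall f : L2, T f = f \o @phi k eta :> (vertex k eta -> R[i]).

End L2.
Arguments L2 {R k eta} mu.

(* Main.v *)
Require Import Defs.
From mathcomp Require Import all_boot all_order all_algebra.
From mathcomp Require Import all_classical all_reals all_analysis.
From mathcomp Require Import complex ring.
Import Order.TTheory GRing.Theory Num.Theory.
Import ComplexField.Normc.
Local Open Scope classical_set_scope.
Local Open Scope ring_scope.

(** Write [m y] for the mass of a vertex [y], [M y] for the mass of the fibre
    of [phi] over [y], and [h y = M y / m y], so that [T^* T] is multiplication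
    by [h] ([adjoint_pair_comp]).

    If [phi x = phi z], then [m z *: delta x - m x *: delta z] lies in the
    kernel of [T^*], and [T^* T] multiplies its two terms by [h x] and [h z].
    The kernel condition therefore forces [h x = h z] ([fibre_ratio_cst]): [h]
    is constant on the fibres of [phi].  The 2-isometry identity at
    [delta (phi x)] then becomes, by [two_isometry_fibre],
<<
    m (phi x) - 2 * M (phi x) + h x * M (phi x) = 0
>>
    Every circuit point other than the last has a one-point fibre, made of its
    successor on the circuit, so this identity says that [M - m] takes one and
    the same value [d] along the whole circuit.  Let [x0] and [xk] be the first
    and last circuit points; [xk = phi x0].  The identity at [xk] reads
    [(h x0 - 1) * M xk = d], while [d = (h x0 - 1) * m x0] at [x0].  But
    [M xk > m x0], since the fibre over [xk] contains a branch point besides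
    [x0]; hence [h x0 = 1] and [d = 0].  Consequently [m] is constant along the
    circuit, and [M xk = m xk = m x0] is a contradiction.

    Since the adjoint is given by a choice operator, every adjoint that occurs
    is found by exhibiting a vector with its defining property
    ([adjoint_pair], [adjoint_pairE]).  The only infinite sum is hidden in
    [integral_comp], the change of variables along [phi], which is needed
    because the fibre over [xk] may be infinite. *)

(** * Change of variables on the countable vertex set *)

Section DiscreteMeasure.
Context {R : realType} {k : nat} {eta : option nat}.
Implicit Types (mu : {measure set (vertex k eta) -> \bar R}).
Implicit Types (A S : set (vertex k eta)).

Lemma measurable_fun_vertex d (U : measurableType d) S (f : vertex k eta -> U) :
  measurable_fun S f.
Proof. by []. Qed.

(** An injection into [nat], which makes countable additivity applicable. *)
Definition vertex_code (x : vertex k eta) : nat :=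
  match x with
  | Circuit i => pickle (inl (i : nat) : nat + nat * nat)
  | Branch i j => pickle (inr (sval i, j) : nat + nat * nat)
  end.

Lemma vertex_code_inj : injective vertex_code.
Proof.
move=> [i|[i ?] j] [i'|[i' ?] j'];
  move=> /(pcan_inj (@pickleK (nat + nat * nat)%type)) // [].
  by move=> /ord_inj ->.
move=> /= ii' ->; subst i'.
by congr (Branch (exist _ _ _)); exact: Prop_irrelevance.
Qed.

(** A subset of [S] is a countable disjoint union of its level sets under
    [vertex_code], which are empty or singletons. *)
Lemma eq_measure_vertex (m1 m2 : {measure set (vertex k eta) -> \bar R}) S :
  (forall x, S x -> m1 [set x] = m2 [set x]) ->
  forall A, A `<=` S -> m1 A = m2 A.
Proof.
move=> m12 A AS.
pose F n := A `&` [set x | vertex_code x = n].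
have -> : A = \bigcup_n F n.
  by apply/seteqP; split=> [x Ax|x [n _] []//]; exists (vertex_code x).
have tF : trivIset setT F.
  by move=> i j _ _ [x [[_ <-] [_ <-]]].
rewrite !measure_bigcup//; apply: eq_eseriesr => n _.
have [->|/set0P[x [Ax xn]]] := eqVneq (F n) set0; first by rewrite !measure0.
have -> : F n = [set x].
  apply/seteqP; split=> [y [_ yn]|_ ->]; last by split.
  by apply: vertex_code_inj; rewrite [LHS]yn xn.
exact/m12/AS.
Qed.

Local Open Scope ereal_scope.

(** On the support of [w], the image of [mu] under [p] and [c] times [mu] have
    the same point masses, hence the same integral of [w]. *)
Lemma ge0_integral_comp mu (p : vertex k eta -> vertex k eta)
    (c : {nonneg R}) (w : vertex k eta -> \bar R) :
  (forall y, 0 <= w y) ->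
  (forall y, w y != 0 -> mu (p @^-1` [set y]) = c%:num%:E * mu [set y]) ->
  \int[mu]_x w (p x) = c%:num%:E * \int[mu]_y w y.
Proof.
move=> w0 cS.
pose S := [set y | w y != 0].
have wS : w = w \_ S.
  apply/funext => y; rewrite patchE; case: ifPn => //.
  by rewrite notin_setE /S /= => /negP; rewrite negbK => /eqP ->.
have mp : measurable_fun setT p by exact: measurable_fun_vertex.
rewrite -[LHS](@ge0_integral_pushforward _ _ _ _ _ p mp mu setT w)//.
rewrite wS -!integral_mkcond -ge0_integral_mscale//.
apply: eq_measure_integral => A _.
exact: (eq_measure_vertex _ _ S).
Qed.

Lemma integral_comp mu (p : vertex k eta -> vertex k eta)
    (c : {nonneg R}) (w : vertex k eta -> \bar R) :
  mu.-integrable setT w ->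
  (forall y, w y != 0 -> mu (p @^-1` [set y]) = c%:num%:E * mu [set y]) ->
  \int[mu]_x w (p x) = c%:num%:E * \int[mu]_y w y.
Proof.
move=> iw cS.
have part (v : vertex k eta -> \bar R) : (forall y, 0 <= v y) ->
    (forall y, w y = 0 -> v y = 0) ->
    \int[mu]_x v (p x) = c%:num%:E * \int[mu]_y v y.
  move=> v0 vw; apply: ge0_integral_comp => // y vy; apply: cS.
  exact: contra_neq (vw y) vy.
rewrite integralE [in RHS]integralE muleBr//; last first.
  by apply: fin_num_adde_defl; rewrite fin_numN integrable_neg_fin_num.
congr (_ - _).
  rewrite -part//; first by apply: eq_integral => x _; rewrite !funeposE.
  by move=> y wy; rewrite funeposE wy maxxx.
rewrite -part//; first by apply: eq_integral => x _; rewrite !funenegE.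
by move=> y wy; rewrite funenegE wy oppe0 maxxx.
Qed.

Local Close Scope ereal_scope.
End DiscreteMeasure.

(** * Inner products and point vectors *)

Section HilbertSpace.
Context {R : realType} {k : nat} {eta : option nat}.
Context (mu : {measure set (vertex k eta) -> \bar R}).
Implicit Types f g : L2 mu.

Lemma normc_L2_Lfun f : (@normc R \o f) \in Lfun mu 2%:E.
Proof.
case: f => f fL /=; have := fL; rewrite [in X in X -> _]inE => /= fn.
by apply/andP; rewrite !inE/=; split.
Qed.

Lemma complex_scalarM (a : R) (z : R[i]) :
  a%:C%C * z = Complex (a * complex.Re z) (a * complex.Im z).
Proof.
case: z => p q; apply/eqP.
by rewrite eq_complex /= !mul0r subr0 addr0 !eqxx.
Qed.

Lemma Re_le_normc (z : R[i]) : `|complex.Re z| <= normc z.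
Proof. by case: z => a b /=; rewrite -sqrtr_sqr ler_wsqrtr// lerDl sqr_ge0. Qed.

Lemma Im_le_normc (z : R[i]) : `|complex.Im z| <= normc z.
Proof. by case: z => a b /=; rewrite -sqrtr_sqr ler_wsqrtr// lerDr sqr_ge0. Qed.

Lemma normc_conj (z : R[i]) : normc z^*%C = normc z.
Proof. by case: z => a b /=; rewrite sqrrN. Qed.

(** Stated for a general [l] so as to cover the real and the imaginary part of
    an inner product at once. *)
Lemma integrable_inner (l : R[i] -> R) f g :
  (forall z, `|l z| <= normc z) ->
  mu.-integrable setT (EFin \o (fun x => l (f x * (g x)^*%C))).
Proof.
move=> lle.
have /Lfun1_integrable := Lfun2_mul_Lfun1 (normc_L2_Lfun f) (normc_L2_Lfun g).
apply: le_integrable => //= x _.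
rewrite lee_fin (@ger0_norm _ (_ * _)); last first.
  by apply: mulr_ge0; exact: le_trans (normr_ge0 _) (Re_le_normc _).
by rewrite (le_trans (lle _))// normcM normc_conj.
Qed.

Lemma innerD f g h : inner f (g + h) = inner f g + inner f h.
Proof.
rewrite /inner; congr Complex.
  rewrite -RintegralD//; try by apply: integrable_inner; exact: Re_le_normc.
  by apply: eq_Rintegral => x _; rewrite rmorphD mulrDr raddfD.
rewrite -RintegralD//; try by apply: integrable_inner; exact: Im_le_normc.
by apply: eq_Rintegral => x _; rewrite rmorphD mulrDr raddfD.
Qed.

Lemma innerZ (a : R) f g : inner f (a%:C%C *: g) = a%:C%C * inner f g.
Proof.
have fE x : f x * (L2val (a%:C%C *: g) x)^*%C = a%:C%C * (f x * (g x)^*%C).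
  rewrite mulrCA; congr (_ * _); rewrite -[L2val _ x]/(a%:C%C * g x) rmorphM.
  by congr (_ * _); rewrite /= oppr0.
rewrite complex_scalarM /inner /=; congr Complex.
  rewrite -RintegralZl//; last by apply: integrable_inner; exact: Re_le_normc.
  by apply: eq_Rintegral => x _; rewrite [in LHS]fE complex_scalarM.
rewrite -RintegralZl//; last by apply: integrable_inner; exact: Im_le_normc.
by apply: eq_Rintegral => x _; rewrite [in LHS]fE complex_scalarM.
Qed.

Lemma eq_L2 f g : (forall x, f x = g x) -> f = g.
Proof. by move=> fg; apply: val_inj; apply/funext. Qed.

Context (mu_fin : forall x, (mu [set x] < +oo)%E).

Definition mass x : R := fine (mu [set x]).

Local Notation m := mass.

Lemma Rintegral_support1 (F : vertex k eta -> R) y :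
  (forall x, x <> y -> F x = 0) -> \int[mu]_x F x = F y * m y.
Proof.
move=> F0; rewrite -Rintegral_cst//.
transitivity (\int[mu]_(x in [set y]) F x).
  rewrite [RHS]Rintegral_mkcond; apply: eq_Rintegral => x _; rewrite patchE.
  by case: ifPn => //; rewrite notin_setE; exact: F0.
by apply: eq_Rintegral => x; rewrite inE => ->.
Qed.

Lemma delta_L2 y : (fun x => (x == y)%:R : R[i]) \in L2fun mu.
Proof.
rewrite inE /= /L2norm unlock; apply: poweR_lty.
rewrite (eq_integral (fun x => (\1_[set y] x)%:E)).
  by rewrite integral_indic// setIT.
move=> x _; rewrite indicE /=.
have [->|/eqP xy] := eqVneq x y.
  by rewrite mem_set// normc1 normr1 powR1.
by rewrite memNset// normc0 normr0 powR0// pnatr_eq0.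
Qed.

Definition delta y : L2 mu := MkL2 (delta_L2 y).

Lemma deltaxx y : delta y y = 1.
Proof. by rewrite /= eqxx. Qed.

Lemma inner_delta f y : inner f (delta y) = (m y)%:C%C * f y.
Proof.
rewrite /inner !(Rintegral_support1 _ y) /=.
- rewrite eqxx rmorph1 mulr1; case: (f y) => p q /=.
  by rewrite complex_scalarM !(mulrC _ (m y)).
- by move=> x /eqP/negPf ->; rewrite rmorph0 mulr0.
- by move=> x /eqP/negPf ->; rewrite rmorph0 mulr0.
Qed.

Lemma inner_deltal f y : inner (delta y) f = (m y)%:C%C * (f y)^*%C.
Proof.
rewrite /inner !(Rintegral_support1 _ y) /=.
- rewrite eqxx mul1r; case: (f y) => p q /=.
  by rewrite complex_scalarM !(mulrC _ (m y)).
- by move=> x /eqP/negPf ->; rewrite mul0r.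
- by move=> x /eqP/negPf ->; rewrite mul0r.
Qed.

Context (mu_pos : forall x, (0 < mu [set x])%E).

Lemma mass_gt0 x : 0 < m x.
Proof. by rewrite /mass fine_gt0// mu_pos mu_fin. Qed.

Lemma massE x : mu [set x] = (m x)%:E.
Proof. by rewrite /mass fineK// ge0_fin_numE. Qed.

(** * Adjoints of a composition operator *)

Context (T : L2 mu -> L2 mu).

(** The graph of the adjoint: as a relation it is closed under linear
    combinations, whereas the value of [adjoint] at a vector is meaningful only
    once some vector is known to be related to it. *)
Definition adjoint_pair g g' := forall f, inner (T f) g = inner f g'.

(** Testing against the point vectors shows that the defining property of the
    adjoint determines it. *)
Lemma adjoint_pairE g h : adjoint_pair g h -> adjoint T g = h.
Proof.
move=> gh; have gh' : adjoint_pair g (adjoint T g).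
  exact: (@xgetPex _ 0 [set h | adjoint_pair g h] (ex_intro _ h gh)).
apply: eq_L2 => y; apply: (can_inj (@conjcK R)).
have := gh (delta y); rewrite gh' !inner_deltal => /mulfI; apply.
by rewrite eq_complex /= eqxx andbT gt_eqF// mass_gt0.
Qed.

Lemma adjoint_pairD g1 g2 h1 h2 :
  adjoint_pair g1 h1 -> adjoint_pair g2 h2 -> adjoint_pair (g1 + g2) (h1 + h2).
Proof. by move=> gh1 gh2 f; rewrite !innerD gh1 gh2. Qed.

Lemma adjoint_pairZ (a : R) g h :
  adjoint_pair g h -> adjoint_pair (a%:C%C *: g) (a%:C%C *: h).
Proof. by move=> gh f; rewrite !innerZ gh. Qed.

Context (T_comp : is_composition_operator T).

Lemma TE f x : T f x = f (phi x).
Proof. by rewrite T_comp. Qed.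

Definition fibre_mass y : R := fine (mu (@phi k eta @^-1` [set y])).

Local Notation M := fibre_mass.

(** The indicator of a fibre is the image under [T] of a point vector, so it
    is square-integrable. *)
Lemma fibre_fin y : (mu (@phi k eta @^-1` [set y]) < +oo)%E.
Proof.
have /integrable_lty := Lfun2_integrable_sqr (normc_L2_Lfun (T (delta y))).
rewrite (eq_integral (fun x => (\1_(@phi k eta @^-1` [set y]) x)%:E)).
  by rewrite integral_indic// setIT; exact.
move=> x _; rewrite indicE /= TE /=.
have [xy|/eqP xy] := eqVneq (phi x) y.
  by rewrite mem_set// normc1 expr1n.
by rewrite memNset// normc0 expr0n.
Qed.

Lemma fibre_massE y : mu (@phi k eta @^-1` [set y]) = (M y)%:E.
Proof. by rewrite /fibre_mass fineK// ge0_fin_numE// fibre_fin. Qed.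

Definition fibre_ratio y : R := M y / m y.

Local Notation h := fibre_ratio.

Lemma fibre_ratio_ge0 y : 0 <= h y.
Proof. by rewrite /fibre_ratio divr_ge0// fine_ge0. Qed.

Lemma measure_fibre y :
  mu (@phi k eta @^-1` [set y]) = ((h y)%:E * mu [set y])%E.
Proof.
rewrite fibre_massE massE /fibre_ratio -EFinM divfK//.
by rewrite gt_eqF// mass_gt0.
Qed.

(** [T^* T] is multiplication by [fibre_ratio].  Only vectors on whose support
    this ratio is constant are considered: the product is then a multiple of
    [u], hence again square-integrable. *)
Lemma adjoint_pair_comp (c : R) (u : L2 mu) : 0 <= c ->
  (forall y, u y != 0 -> h y = c) -> adjoint_pair (T u) (c%:C%C *: u).
Proof.
move=> c0 hc f; rewrite innerZ /inner.
have cint (l : R[i] -> R) : (forall z, `|l z| <= normc z) ->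
    \int[mu]_x l (T f x * (T u x)^*%C) = c * \int[mu]_y l (f y * (u y)^*%C).
  move=> lle.
  have lint := integrable_inner l f u lle.
  rewrite /Rintegral -[c in RHS]/(fine c%:E) -fineM//; last first.
    exact: integrable_fin_num.
  congr fine.
  under eq_integral do rewrite !TE.
  apply: (integral_comp mu (@phi k eta) (NngNum c0) _ lint) => y wy /=.
  rewrite measure_fibre hc//; apply: contra_neq wy => uy.
  have : `|l 0| <= 0 by rewrite (le_trans (lle _))// normc0.
  by rewrite normr_le0 => /eqP l0; rewrite /= uy rmorph0 mulr0 l0.
rewrite !cint; [|exact: Im_le_normc|exact: Re_le_normc].
by rewrite complex_scalarM.
Qed.

Lemma adjoint_pair_delta x :
  adjoint_pair (delta x) ((m x / m (phi x))%:C%C *: delta (phi x)).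
Proof.
move=> f; rewrite innerZ !inner_delta TE mulrA -rmorphM divfK//.
by rewrite gt_eqF// mass_gt0.
Qed.

Lemma adjoint_pair_comp_delta y :
  adjoint_pair (T (delta y)) ((h y)%:C%C *: delta y).
Proof.
apply: adjoint_pair_comp; first exact: fibre_ratio_ge0.
by move=> x /=; case: (eqVneq x y) => [->//|]; rewrite eqxx.
Qed.

Lemma delta_scale_eq0 (a : R) y : a%:C%C *: delta y = 0 -> a = 0.
Proof.
move=> /(congr1 (fun f : L2 mu => L2val f y)).
rewrite -[LHS]/(a%:C%C * delta y y) deltaxx mulr1.
by case.
Qed.

(** The kernel condition is tested on the combination of two points of one
    fibre which the adjoint annihilates. *)
Lemma fibre_ratio_cst : kernel_condition T ->
  forall x z, phi x = phi z -> h x = h z.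
Proof.
move=> ker x z xz.
pose g : L2 mu := (m z)%:C%C *: delta x + (- m x)%:C%C *: delta z.
have g0 : adjoint T g = 0.
  rewrite (adjoint_pairE _ _ (adjoint_pairD _ _ _ _
    (adjoint_pairZ _ _ _ (adjoint_pair_delta x))
    (adjoint_pairZ _ _ _ (adjoint_pair_delta z)))).
  rewrite -xz !scalerA -scalerDl -!rmorphM -rmorphD.
  by rewrite (_ : _ + _ = 0) ?rmorph0 ?scale0r//; ring.
have ATg : adjoint T (T g) = (m z)%:C%C *: ((h x)%:C%C *: delta x)
    + (- m x)%:C%C *: ((h z)%:C%C *: delta z).
  have -> : T g = (m z)%:C%C *: T (delta x) + (- m x)%:C%C *: T (delta z).
    by apply: eq_L2 => v; rewrite TE /= !T_comp.
  by apply: adjoint_pairE; apply: adjoint_pairD; apply: adjoint_pairZ;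
    exact: adjoint_pair_comp_delta.
have : adjoint T (adjoint T (T g)) = 0 by apply: ker; exists g.
rewrite ATg (adjoint_pairE _ _ (adjoint_pairD _ _ _ _
  (adjoint_pairZ _ _ _ (adjoint_pairZ _ _ _ (adjoint_pair_delta x)))
  (adjoint_pairZ _ _ _ (adjoint_pairZ _ _ _ (adjoint_pair_delta z))))).
rewrite -xz !scalerA -scalerDl -!rmorphM -rmorphD => /delta_scale_eq0 e.
have my := mass_gt0 (phi x); have mx := mass_gt0 x; have mz := mass_gt0 z.
have : (h x - h z) * (m x * m z / m (phi x)) = 0 by rewrite -[RHS]e; ring.
move/eqP; rewrite mulf_eq0 subr_eq0 => /predU1P[//|].
by rewrite gt_eqF// divr_gt0// mulr_gt0.
Qed.

(** The 2-isometry identity at the point vector of [phi x], whose image under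
    [T] is the indicator of the fibre of [x], an eigenvector of [T^* T]. *)
Lemma two_isometry_fibre : two_isometry T -> forall x,
  (forall z, phi z = phi x -> h z = h x) ->
  m (phi x) - 2 * M (phi x) + h x * M (phi x) = 0.
Proof.
move=> iso x hx; set y := phi x.
have Tdy := adjoint_pairE _ _ (adjoint_pair_comp_delta y).
have TTdy : adjoint T (T (T (delta y))) = (h x)%:C%C *: T (delta y).
  apply: adjoint_pairE; apply: adjoint_pair_comp; first exact: fibre_ratio_ge0.
  move=> w; rewrite TE /=; case: (eqVneq (phi w) y) => [/hx->//|].
  by rewrite eqxx.
have := iso (delta y); rewrite Tdy TTdy.
rewrite (adjoint_pairE _ _ (adjoint_pairZ _ _ _ (adjoint_pair_comp_delta y))).
have -> : (2%:R : R[i]) = 2%:R%:C%C by rewrite rmorph_nat.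
rewrite !scalerA -[X in X - _](scale1r (delta y)) -scalerBl -scalerDl.
rewrite -!rmorphM -[1](rmorph1 (real_complex R)) -rmorphB -rmorphD.
move=> /delta_scale_eq0 e.
have my := mass_gt0 y.
rewrite -[RHS](mul0r (m y)) -e /fibre_ratio; field.
by rewrite !gt_eqF// mass_gt0.
Qed.

End HilbertSpace.

(** * Fibres over the circuit *)

Lemma preimage_phi_Circuit k eta j : (j < k)%N ->
  @phi k eta @^-1` [set Circuit (inord j)] = [set Circuit (inord j.+1)].
Proof.
move=> jk; have jk1 : (j < k.+1)%N by exact: ltnW.
apply/seteqP; split=> [[i|i [|l]] //= []|_ ->] /=.
- move=> /(congr1 (@nat_of_ord _)) /=; rewrite inordK// => ij.
  congr Circuit; apply: val_inj; rewrite /= inordK//.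
  case: i ij => [[|i] ik] /=; last first.
    by rewrite modnDr modn_small ?(ltnW ik)// => ->.
  by rewrite modn_small// => kj; move: jk; rewrite kj ltnn.
- move=> /(congr1 (@nat_of_ord _)) /=; rewrite inordK// => kj.
  by move: jk; rewrite kj ltnn.
- congr Circuit; apply: val_inj => /=; rewrite !inordK//.
  by rewrite modnDr modn_small.
Qed.

Lemma phi_Circuit0 k eta : @phi k eta (Circuit (inord 0)) = Circuit (inord k).
Proof.
by congr Circuit; apply: val_inj => /=; rewrite !inordK// add0n modn_small.
Qed.

Lemma phi_Branch0 k eta i : @phi k eta (Branch i 0) = Circuit (inord k).
Proof. by congr Circuit; apply: val_inj => /=; rewrite inordK. Qed.

Lemma branch_index_inhabited eta : eta <> Some 0%N -> branch_index eta.
Proof. by case: eta => [[|n]|] // _; exists 0%N. Qed.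

Theorem theorem4p9 (R : realType) (k : nat) (eta : option nat)
    (eta_pos : eta <> Some 0%N)
    (mu : {measure set (vertex k eta) -> \bar R})
    (mu_pos : forall x, (0 < mu [set x])%E)
    (mu_fin : forall x, (mu [set x] < +oo)%E)
    (T : L2 mu -> L2 mu)
    (T_comp : is_composition_operator T)
    (T_bounded : bounded_operator T)
    (T_2iso : two_isometry T) :
  ~ kernel_condition T.
Proof.
move=> ker.
pose m := mass mu; pose M := fibre_mass mu.
have m0 x : 0 < m x by exact: mass_gt0.
have key x : m (phi x) - 2 * M (phi x) + M x / m x * M (phi x) = 0.
  apply: (two_isometry_fibre mu mu_fin mu_pos T T_comp T_2iso x) => z.
  exact: (fibre_ratio_cst mu mu_fin mu_pos T T_comp ker).
pose x_ j : vertex k eta := Circuit (inord j).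
have MS j : (j < k)%N -> M (x_ j) = m (x_ j.+1).
  by move=> jk; rewrite /M /fibre_mass preimage_phi_Circuit.
have phiS j : (j < k)%N -> phi (x_ j.+1) = x_ j.
  move=> jk; suff : (@phi k eta @^-1` [set x_ j]) (x_ j.+1) by [].
  by rewrite preimage_phi_Circuit.
pose d := M (x_ 0%N) - m (x_ 0%N).
(* For one-point fibres the identity says that consecutive values of
   [M - m] agree. *)
have dE j : (j <= k)%N -> M (x_ j) - m (x_ j) = d.
  elim: j => // j IH jk; rewrite -IH ?(ltnW jk)//.
  have := key (x_ j.+1); rewrite phiS// MS// divfK ?gt_eqF// => e.
  by apply/eqP; rewrite -subr_eq0 -e; apply/eqP; ring.
have M_gt : m (x_ 0%N) < M (x_ k).
  pose z : vertex k eta := Branch (branch_index_inhabited _ eta_pos) 0%N.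
  have : (mu [set x_ 0%N] + mu [set z] <= mu (@phi k eta @^-1` [set x_ k]))%E.
    rewrite -measureU//; last by apply/seteqP; split=> // _ [->].
    apply: le_measure; rewrite ?inE// => _ [->|->].
      exact: phi_Circuit0.
    exact: phi_Branch0.
  rewrite !(massE mu mu_fin) (fibre_massE mu mu_fin T T_comp) -EFinD lee_fin.
  by move=> le; apply: lt_le_trans le; rewrite ltrDl; exact: m0.
(* Eliminating [h (x_ 0)] between the identity over the last circuit point
   and the definition of [d]. *)
have d0 : d = 0.
  have := key (x_ 0%N); rewrite phi_Circuit0 -/(x_ k) => e.
  have : (M (x_ k) - m (x_ 0%N)) * d = 0.
    rewrite -[RHS](mul0r (m (x_ 0%N))) -e.
    have -> : m (x_ k) = M (x_ k) - d by rewrite -(dE k)//; ring.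
    by rewrite /d; field; rewrite gt_eqF.
  by move=> /eqP; rewrite mulf_eq0 subr_eq0 gt_eqF//= => /eqP.
have m_cst j : (j <= k)%N -> m (x_ j) = m (x_ 0%N).
  elim: j => // j IH jk; rewrite -MS// -IH ?(ltnW jk)//.
  by apply/eqP; rewrite -subr_eq0 dE ?d0 ?(ltnW jk).
by move: M_gt; rewrite -(m_cst k)// -subr_gt0 dE// d0 ltxx.
Qed.
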